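(* For any boundary defining function $\sigma\in C^\infty(X)$ it holds $$L(g,\sigma;\lambda)+\sigma^{\lambda-1}\circ\left(\Delta_{\sigma^{-2}g}-\lambda(n+\lambda)\operatorname{Id}\right)\circ\sigma^{-\lambda}=\lambda(n+\lambda)\,\sigma^{-1}\left(\mathcal{S}(g,\sigma)-1\right)\operatorname{Id},\qquad\lambda\in\mathbb{C},$$ as an identity of operators near the boundary of $X$, i.e., acting on functions in $C^\infty(X^\circ)$ with support in a sufficiently small neighborhood of $M$.
   Context: Setting: $(X,g)$ is a compact Riemannian manifold of dimension $n+1$ with boundary $M$ (of dimension $n$), $X^\circ=X\setminus M$. A boundary defining function is $\sigma\in C^\infty(X)$ (smooth up to the boundary) with $\sigma^{-1}(0)=M$, $\sigma>0$ on $X^\circ$, $d\sigma|_M\neq0$. $\Delta_g=\operatorname{div}\operatorname{grad}$ denotes the non-positive Laplacian of a metric $g$, and $\nabla_V(u)=\langle du,V\rangle$. Put $2n\,\mathsf{J}=\operatorname{scal}(g)$, $(n+1)\rho=-\Delta_g(\sigma)-\sigma\mathsf{J}$, $\mathcal{S}(g,\sigma)=|d\sigma|_g^2+2\sigma\rho$. The Laplace-Robin operator is $$L(g,\sigma;\lambda)=(n+2\lambda-1)(\nabla_{\operatorname{grad}_g(\sigma)}+\lambda\rho)-\sigma(\Delta_g+\lambda\mathsf{J}).$$ Powers of $\sigma$ are regarded as multiplication operators. *)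

(* Defs.v *)
From HB Require Import structures.
From mathcomp Require Import all_boot all_order all_algebra.
From mathcomp Require Import all_classical all_reals all_analysis.
From mathcomp Require Import complex.

Set Implicit Arguments.
Unset Strict Implicit.
Unset Printing Implicit Defensive.

Import Order.TTheory GRing.Theory Num.Theory.
Import numFieldNormedType.Exports.

Local Open Scope classical_set_scope.
Local Open Scope ring_scope.
Local Open Scope complex_scope.

(* Calculus on the closed half-space x_0 >= 0 of R^(n+1), points being rows. *)

Section HalfSpace.
Context {R : realType} {n : nat}.
Implicit Types (x y : 'rV[R]_n.+1) (f : 'rV[R]_n.+1 -> R) (i : 'I_n.+1).

Definition halfspace : set 'rV[R]_n.+1 := [set x | 0 <= x 0 0].

Definition evec i : 'rV[R]_n.+1 := delta_mx 0 i.

(* The difference quotient only uses points of the half-space: this is the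
   ordinary partial derivative when 0 < x 0 0, and for x 0 0 = 0 and i = 0 the
   one-sided one. *)
Definition partial i f x : R :=
  lim ((fun t : R => t^-1 * (f (x + t *: evec i) - f x))
         @ within [set t : R | halfspace (x + t *: evec i)] (0 : R)^').

Definition iter_partial (s : seq 'I_n.+1) f : 'rV[R]_n.+1 -> R :=
  foldr (fun i h x => 'D_(evec i) h x) f s.

Definition smooth_open (U : set 'rV[R]_n.+1) f : Prop :=
  forall (s : seq 'I_n.+1) x, U x -> differentiable (iter_partial s f) x.

(* Smoothness on an arbitrary subset: local smooth extendability. *)
Definition smooth_set (A : set 'rV[R]_n.+1) f : Prop :=
  forall x, A x -> exists (U : set 'rV[R]_n.+1) (F : 'rV[R]_n.+1 -> R),
    [/\ open U, U x, smooth_open U F & forall y, U y -> A y -> F y = f y].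

End HalfSpace.

(* Compact smooth manifold with (possibly empty) boundary of dimension n + 1.
   The map param c is the inverse of the chart coord c; its values outside
   coord c @` dom c are irrelevant.  Second countability follows from
   compactness. *)
Record manifold (R : realType) (n : nat) := Manifold {
  space :> topologicalType;
  space_compact : compact [set: space];
  space_hausdorff : hausdorff_space space;
  chart : Type;
  dom : chart -> set space;
  coord : chart -> space -> 'rV[R]_n.+1;
  param : chart -> 'rV[R]_n.+1 -> space;
  dom_cover : forall p, exists c, dom c p;
  dom_open : forall c, open (dom c);
  coord_image : forall c, exists2 V : set 'rV[R]_n.+1,
    open V & coord c @` dom c = V `&` halfspace;
  coordK : forall c p, dom c p -> param c (coord c p) = p;
  coord_continuous : forall c, {within dom c, continuous (coord c)};
  param_continuous : forall c,
    {within coord c @` dom c, continuous (param c)};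
  transition_smooth : forall c d (k : 'I_n.+1),
    smooth_set (coord c @` (dom c `&` dom d))
               (fun x => coord d (param c x) 0 k) }.

Section Manifold.
Context {R : realType} {n : nat} (X : manifold R n).
Implicit Types (c d : chart X) (p : X) (f u : X -> R) (W : set X).

Definition boundary : set X :=
  [set p | exists2 c, dom c p & coord c p 0 0 = 0].

Definition inner : set X := ~` boundary.

Definition smooth_on W f : Prop :=
  forall c, smooth_set (coord c @` (dom c `&` W)) (f \o param c).

Definition chart_at p : chart X := projT1 (cid (dom_cover p)).

(* The partial derivative of f with respect to the i-th coordinate of c. *)
Definition dchart c (i : 'I_n.+1) f p : R :=
  partial i (f \o param c) (coord c p).

(* Tensor fields are given by their components in each chart.  An invariantly
   defined scalar is evaluated at p in the chart chart_at p; for components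
   obeying the tensor transformation laws the choice of chart is immaterial. *)
Definition vfield := chart X -> X -> 'rV[R]_n.+1.
Definition tensor2 := chart X -> X -> 'M[R]_n.+1.

Definition jacobian_mx c d p : 'M[R]_n.+1 :=
  \matrix_(i, k) dchart c i (fun q => coord d q 0 k) p.

Record riemannian_metric := RiemannianMetric {
  metric :> tensor2;
  metric_smooth : forall c (i j : 'I_n.+1),
    smooth_set (coord c @` dom c) (fun x => metric c (param c x) i j);
  metric_sym : forall c p, dom c p -> (metric c p)^T = metric c p;
  metric_posdef : forall c p (v : 'rV[R]_n.+1), dom c p -> v != 0 ->
    0 < (v *m metric c p *m v^T) 0 0;
  metric_transform : forall c d p, dom c p -> dom d p ->
    metric c p = jacobian_mx c d p *m metric d p *m (jacobian_mx c d p)^T }.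

Implicit Type g : tensor2.

Definition ginv g c p : 'M[R]_n.+1 := invmx (g c p).

(* christoffel g c k i j is Gamma^k_ij. *)
Definition christoffel g c (k i j : 'I_n.+1) p : R :=
  2^-1 * \sum_l ginv g c p k l *
    (dchart c i (fun q => g c q j l) p + dchart c j (fun q => g c q i l) p
     - dchart c l (fun q => g c q i j) p).

(* riemann g c l k i j is R^l_kij, the l-component of R(d_i, d_j) d_k with
   R(U, V) = [nabla_U, nabla_V] - nabla_[U, V]. *)
Definition riemann g c (l k i j : 'I_n.+1) p : R :=
  dchart c i (christoffel g c l j k) p - dchart c j (christoffel g c l i k) p
  + \sum_m (christoffel g c l i m p * christoffel g c m j k p
            - christoffel g c l j m p * christoffel g c m i k p).

Definition ricci g c (j k : 'I_n.+1) p : R := \sum_i riemann g c i k i j p.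

(* Positive on round spheres. *)
Definition scal g p : R :=
  let c := chart_at p in \sum_j \sum_k ginv g c p j k * ricci g c j k p.

Definition grad g u : vfield :=
  fun c p => (\row_j dchart c j u p) *m ginv g c p.

(* <du, V> *)
Definition nabla (V : vfield) u p : R :=
  let c := chart_at p in \sum_i V c p 0 i * dchart c i u p.

(* The trace of the Levi-Civita covariant derivative of V. *)
Definition div g (V : vfield) p : R :=
  let c := chart_at p in
  \sum_i (dchart c i (fun q => V c q 0 i) p
          + \sum_j christoffel g c i i j p * V c p 0 j).

Definition laplacian g u : X -> R := div g (grad g u).

(* |du|_g^2 *)
Definition dnorm2 g u p : R :=
  let c := chart_at p in
  \sum_i \sum_j ginv g c p i j * dchart c i u p * dchart c j u p.

(* sigma^-2 g, a metric on the set where sigma is nonzero. *)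
Definition conformal g (sigma : X -> R) : tensor2 :=
  fun c p => sigma p ^- 2 *: g c p.

Definition boundary_defining (sigma : X -> R) : Prop :=
  [/\ smooth_on setT sigma,
      sigma @^-1` [set 0] = boundary,
      forall p, inner p -> 0 < sigma p
    & forall p, boundary p -> exists i, dchart (chart_at p) i sigma p != 0].

(* If n = 0 then scal vanishes, and so does this. *)
Definition schoutenJ g p : R := scal g p / (2 * n%:R).

Definition rho g (sigma : X -> R) p : R :=
  (- laplacian g sigma p - sigma p * schoutenJ g p) / n.+1%:R.

Definition calS g (sigma : X -> R) p : R :=
  dnorm2 g sigma p + 2 * sigma p * rho g sigma p.

(* Complex-valued functions; functions in C^oo(inner) are represented by total
   functions on X whose values on the boundary are irrelevant. *)

Definition csmooth_on W (u : X -> R[i]) : Prop :=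
  smooth_on W (fun p => complex.Re (u p)) /\
  smooth_on W (fun p => complex.Im (u p)).

(* The complex-linear extension of a real linear operator. *)
Definition complexify (T : (X -> R) -> X -> R) (u : X -> R[i]) : X -> R[i] :=
  fun p => T (fun q => complex.Re (u q)) p +i* T (fun q => complex.Im (u q)) p.

(* The support of u relative to the open manifold inner. *)
Definition inner_support (u : X -> R[i]) : set X :=
  closure [set p | inner p /\ u p != 0] `&` inner.

(* x ^ z = exp (z ln x), meant for 0 < x. *)
Definition cpow (x : R) (z : R[i]) : R[i] :=
  let a := complex.Re z * ln x in let b := complex.Im z * ln x in
  (expR a * cos b) +i* (expR a * sin b).

Definition laplace_robin g (sigma : X -> R) (lambda : R[i])
    (u : X -> R[i]) : X -> R[i] :=
  fun p =>
    (n%:R + 2 * lambda - 1) *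
      (complexify (nabla (grad g sigma)) u p
       + lambda * (rho g sigma p)%:C * u p)
    - (sigma p)%:C *
      (complexify (laplacian g) u p + lambda * (schoutenJ g p)%:C * u p).

Definition shifted_laplacian g (lambda : R[i]) (u : X -> R[i]) : X -> R[i] :=
  fun p => complexify (laplacian g) u p - lambda * (n%:R + lambda) * u p.

End Manifold.

Arguments boundary {R n} X.
Arguments inner {R n} X.

(* Main.v *)
Require Import Defs.
From mathcomp Require Import all_boot all_order all_algebra.
From mathcomp Require Import all_classical all_reals all_analysis.
From mathcomp Require Import complex.
From mathcomp Require Import ring.
Import Order.TTheory GRing.Theory Num.Theory.
Import numFieldNormedType.Exports.
Import Defs.
Local Open Scope classical_set_scope.
Local Open Scope ring_scope.
Local Open Scope complex_scope.

Set Implicit Arguments.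
Unset Strict Implicit.
Unset Printing Implicit Defensive.

(** The identity is local and holds on the whole interior of X, so the
    neighbourhood of the boundary can be taken to be X itself.

    Write s for the defining function, <,> for the inner product of gradients
    and v = s^(-lambda) u.  In dimension n + 1 the conformal change of metric
    gives (laplacian_conformal)
      Delta_(s^-2 g) v = s^2 Delta_g v - (n - 1) s <ds, dv>,
    and for any metric the Leibniz and chain rules give (laplacian_compM)
      Delta (phi(s) u) = phi(s) Delta u + 2 phi'(s) <ds, du>
                         + (phi'(s) Delta s + phi''(s) |ds|^2) u.
    Applying the second formula to the metric s^-2 g with phi(t) = t^(-lambda),
    and then the first one to u and to s, the second and first order terms in u
    of s^(lambda - 1) Delta_(s^-2 g) (s^(-lambda) u) are
      s Delta u - (n + 2 lambda - 1) <ds, du>,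
    which cancel against those of the Laplace-Robin operator.  What remains is
    a multiple of u; after substituting Delta s = - (n + 1) rho - s J it is
    lambda (n + lambda) (|ds|^2 + 2 s rho - 1) / s.

    Since every operator is evaluated at a point p in the one chart attached to
    p, all of this is calculus at the point x = coord c p of the half-space.
    At an interior point x does not lie on the wall, so the one-sided partial
    derivatives are directional derivatives 'D, and laplacianE writes the
    Laplacian as a second order operator in them.  That interior points are
    interior along with a neighbourhood is a consequence of the existence of
    s: the boundary is the zero set of a continuous function. *)

(** * Directional derivatives on the half-space *)

Section HalfSpaceCalculus.
Context {R : realType} {n : nat}.
Implicit Types (x y v : 'rV[R]_n.+1) (f h : 'rV[R]_n.+1 -> R) (i j : 'I_n.+1).

(** Off the wall, the half-space contains all points close to x on the line
    through x, so restricting the difference quotient to it changes nothing. *)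
Lemma partialE i f x : 0 < x 0 0 -> partial i f x = 'D_(evec i) f x.
Proof.
move=> x0; rewrite /partial /derive.
suff -> : within [set t : R | halfspace (x + t *: evec i)] (0 : R)^' = 0^'.
  by under eq_fun do rewrite [x + _]addrC.
apply/seteqP; split=> A; last first.
  by move=> A0; rewrite /within /=; near=> t => _; near: t; exact: A0.
rewrite /within /= => A0.
have H : \forall t \near (0 : R), halfspace (x + t *: evec i).
  near=> t; rewrite /halfspace /= !mxE /= -lerBlDl sub0r.
  have tx : `|t| < x 0 0 by near: t; exact: (@nbhs0_lt R R).
  have e1 : `|((0 == 0 :> 'I_1) && (0 == i))%:R : R| <= 1.
    by case: (_ && _); rewrite ?normr1 ?normr0.
  rewrite lerNl; apply: le_trans (ltW tx).
  rewrite (le_trans (ler_norm _))// normrN normrM.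
  by rewrite ler_piMr.
have H' : \forall t \near 0^', halfspace (x + t *: evec i).
  by rewrite near_withinE; near=> t => _; near: t; exact: H.
by apply: filterS2 A0 H' => t At; exact: At.
Unshelve. all: by end_near. Qed.

(** The derivative along v is that of the restriction of f to a line, so this is
    the chain rule for functions of one variable. *)
Lemma is_derive_comp1 (phi : R -> R) f x v df dphi :
  is_derive (f x) 1 phi dphi -> is_derive x v f df ->
  is_derive x v (phi \o f) (dphi * df).
Proof.
move=> hphi [fx <-].
have f0 := (derivable1P _ _ _).1 fx.
have df0 : is_derive (0 : R) 1 (fun t => f (t *: v + x)) ('D_v f x).
  split=> //; rewrite /derive /=.
  by under eq_fun do rewrite addr0 scale0r add0r [_ *: 1]mulr1.
have e0 : f (0 *: v + x) = f x by rewrite scale0r add0r.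
have := @is_derive1_comp R phi (fun t => f (t *: v + x)) 0 dphi ('D_v f x).
rewrite e0 => /(_ hphi df0) [c0 cE].
split; first by apply/derivable1P.
rewrite -cE /derive /=.
by under [in RHS]eq_fun do rewrite addr0 scale0r add0r [_ *: 1]mulr1.
Qed.

Lemma is_derive_mul f h x v df dh :
  is_derive x v f df -> is_derive x v h dh ->
  is_derive x v (fun y => f y * h y) (df * h x + f x * dh).
Proof.
move=> hf hh; apply: is_derive_eq (is_deriveM hf hh) _.
by rewrite addrC [_ *: df]mulrC.
Qed.

Lemma is_derive_inv_sqr (t : R) : t != 0 ->
  is_derive t 1 (fun t : R => t ^- 2) (- 2 * t ^- 3).
Proof.
move=> t0.
have d2 := is_deriveX 2 (is_derive_id t 1).
have t20 : (id ^+ 2 : R -> R) t != 0 := expf_neq0 2 t0.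
split; first by apply: derivableV => //; exact: ex_derive d2.
rewrite (deriveV t20 (@ex_derive _ _ _ _ _ _ _ d2)) (@derive_val _ _ _ _ _ _ _ d2).
have -> : (id ^+ 2 : R -> R) t = t ^+ 2 by [].
by rewrite /GRing.scale /=; field.
Qed.

(** The part of smoothness that a second order operator sees: it is stable
    under the products and compositions below by the rules for first
    derivatives alone. *)
Definition twice_derivable f x : Prop :=
  (\forall y \near x, forall i, derivable f y (evec i)) /\
  forall i j, derivable ('D_(evec j) f) x (evec i).

Lemma twice_derivable_at f x i : twice_derivable f x -> derivable f x (evec i).
Proof. by case=> /nbhs_singleton. Qed.

Lemma near_eq_twice_derivable f h x : {near x, f =1 h} ->
  twice_derivable f x -> twice_derivable h x.
Proof.
move=> fh [f1 f2]; split.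
  near=> y; move=> i.
  apply: (@near_eq_derivable _ _ _ f); last by move: i; near: y.
  by near: y; exact: near_join fh.
move=> i j; apply: near_eq_derivable (f2 i j).
by near=> y; apply: near_eq_derive; near: y; exact: near_join fh.
Unshelve. all: by end_near. Qed.

Lemma twice_derivableDZ (F H : 'rV[R]_n.+1 -> R) x (a : R) :
  twice_derivable F x -> twice_derivable H x ->
  (\forall y \near x, forall i,
     'D_(evec i) (F + a *: H) y = 'D_(evec i) F y + a * 'D_(evec i) H y) /\
  twice_derivable (F + a *: H) x.
Proof.
move=> [dF ddF] [dH ddH].
have dFH : \forall y \near x, forall i,
     'D_(evec i) (F + a *: H) y = ('D_(evec i) F + a *: 'D_(evec i) H) y.
  apply: filterS2 dF dH => y Fy Hy i.
  by rewrite deriveD ?deriveZ//; exact: derivableZ.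
split; first exact: dFH.
split.
  apply: filterS2 dF dH => y Fy Hy i.
  by apply: derivableD => //; exact: derivableZ.
move=> i j; apply: (@near_eq_derivable _ _ _ ('D_(evec j) F + a *: 'D_(evec j) H)).
  by apply: filterS dFH => y ->.
by apply: derivableD => //; exact: derivableZ.
Qed.

Lemma smooth_twice_derivable (A : set 'rV[R]_n.+1) f x :
  smooth_set A f -> nbhs x A -> twice_derivable f x.
Proof.
move=> sf Ax; have [U [F [oU Ux sF FE]]] := sf x (nbhs_singleton Ax).
apply: (@near_eq_twice_derivable F).
  by apply: filterS2 Ax (open_nbhs_nbhs (conj oU Ux)) => y ? ?; exact: FE.
split.
  apply: filterS (open_nbhs_nbhs (conj oU Ux)) => y Uy i.
  by apply: diff_derivable; exact: (sF [::]).
by move=> i j; apply: diff_derivable; exact: (sF [:: j]).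
Qed.

Lemma smooth_continuous (A : set 'rV[R]_n.+1) f x :
  smooth_set A f -> nbhs x A -> f @ x --> f x.
Proof.
move=> sf Ax; have [U [F [oU Ux sF FE]]] := sf x (nbhs_singleton Ax).
have FEx : {near x, F =1 f}.
  by apply: filterS2 Ax (open_nbhs_nbhs (conj oU Ux)) => y ? ?; exact: FE.
rewrite -(nbhs_singleton FEx).
have cF : F @ x --> F x := differentiable_continuous (sF [::] x Ux).
have fF : f @ x --> F @ x by apply: (@near_eq_cvg _ _ (nbhs x)); exact: FEx.
exact: cvg_trans fF cF.
Qed.

Lemma sum_mul_delta (F : 'I_n.+1 -> R) j : \sum_i F i * (i == j)%:R = F j.
Proof.
rewrite (bigD1 j)//= eqxx mulr1 big1 ?addr0// => i /negbTE ->.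
by rewrite mulr0.
Qed.

Lemma derivable_prod (I : Type) (s : seq I) (P : pred I)
    (F : I -> 'rV[R]_n.+1 -> R) x v :
  (forall k, derivable (F k) x v) ->
  derivable (fun y => \prod_(k <- s | P k) F k y) x v.
Proof.
move=> dF; elim: s => [|k s IH].
  by under eq_fun do rewrite big_nil; exact: derivable_cst.
under eq_fun do rewrite big_cons; case: (P k) => //.
exact: (derivableM (dF k) IH).
Qed.

Lemma derivable_bigsum (I : Type) (s : seq I) (P : pred I)
    (F : I -> 'rV[R]_n.+1 -> R) x v :
  (forall k, derivable (F k) x v) ->
  derivable (fun y => \sum_(k <- s | P k) F k y) x v.
Proof.
move=> dF; elim: s => [|k s IH].
  by under eq_fun do rewrite big_nil; exact: derivable_cst.
under eq_fun do rewrite big_cons; case: (P k) => //.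
exact: (derivableD (dF k) IH).
Qed.

Lemma derivable_det m (A : 'rV[R]_n.+1 -> 'M[R]_m) x v :
  (forall i j : 'I_m, derivable (fun y => A y i j) x v) ->
  derivable (fun y => \det (A y)) x v.
Proof.
move=> dA; apply: derivable_bigsum => s.
apply: (derivableM (derivable_cst _ _ _)).
by apply: derivable_prod => k; exact: dA.
Qed.

(** By Cramer's rule, the entries of the inverse are quotients of polynomials
    in the entries. *)
Lemma derivable_invmx m (A : 'rV[R]_n.+1 -> 'M[R]_m) x v (i j : 'I_m) :
  (\forall y \near x, A y \in unitmx) ->
  (forall i j : 'I_m, derivable (fun y => A y i j) x v) ->
  derivable (fun y => invmx (A y) i j) x v.
Proof.
move=> uA dA.
apply: (@near_eq_derivable _ _ _ (fun y => (\det (A y))^-1 * (\adj (A y)) i j)).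
  by apply: filterS uA => y uy; rewrite /invmx uy [RHS]mxE.
apply: (@derivableM _ _ (fun y => (\det (A y))^-1)).
  apply: derivableV; last exact: derivable_det.
  by have := nbhs_singleton uA; rewrite unitmxE unitfE.
under eq_fun do rewrite mxE /cofactor.
apply: (derivableM (derivable_cst _ _ _)).
apply: derivable_det => k l.
under eq_fun do rewrite !mxE; exact: dA.
Qed.

End HalfSpaceCalculus.

(** * Operators at an interior point, in coordinates *)

Section InnerPoint.
Context {R : realType} {n : nat} (X : manifold R n).
Implicit Types (c : chart X) (p q : X) (f w sigma : X -> R) (W : set X) (i j k : 'I_n.+1).

Lemma dom_chart_at p : dom (chart_at p) p.
Proof. exact: projT2 (cid (dom_cover p)). Qed.

Lemma inner_coord_gt0 c p : dom c p -> inner X p -> 0 < coord c p 0 0.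
Proof.
move=> dp ip; have [V oV VE] := coord_image c.
have : (coord c @` dom c) (coord c p) by exists p.
rewrite VE => -[_ /= x0]; rewrite lt_neqAle x0 andbT eq_sym; apply/eqP => x00.
by apply: ip; exists c.
Qed.

Lemma near_param c p : dom c p -> inner X p ->
  \forall y \near coord c p,
    [/\ dom c (param c y), coord c (param c y) = y & 0 < y 0 0].
Proof.
move=> dp ip; have [V oV VE] := coord_image c.
have x0 := inner_coord_gt0 dp ip.
have Vx : V (coord c p).
  have : (coord c @` dom c) (coord c p) by exists p.
  by rewrite VE => -[].
have y0 : \forall y \near coord c p, 0 < (y : 'rV[R]_n.+1) 0 0.
  have /= cx := @matrix_normedtype.coord_continuous R 1 n.+1 0 0 (coord c p).
  exact: (cvgr_gt _ cx).
apply: filterS2 y0 (open_nbhs_nbhs (conj oV Vx)) => y y0 Vy.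
have : (V `&` halfspace) y by split=> //; exact: ltW.
by rewrite -VE => -[q dq qy]; move: y0; rewrite -qy coordK.
Qed.

Lemma dchartE c i f p : dom c p -> inner X p ->
  dchart c i f p = 'D_(evec i) (f \o param c) (coord c p).
Proof. by move=> dp ip; rewrite /dchart partialE// inner_coord_gt0. Qed.

Lemma near_dchartE c i f p : dom c p -> inner X p ->
  \forall y \near coord c p,
    dchart c i f (param c y) = 'D_(evec i) (f \o param c) y.
Proof.
move=> dp ip; apply: filterS (near_param dp ip) => y [dy yE y0].
by rewrite /dchart yE partialE.
Qed.

Lemma near_chart_image c p W : dom c p -> inner X p ->
  (\forall y \near coord c p, W (param c y)) ->
  nbhs (coord c p) (coord c @` (dom c `&` W)).
Proof.
move=> dp ip Wp; apply: filterS2 Wp (near_param dp ip) => y Wy [dy yE _].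
by exists (param c y).
Qed.

Lemma smooth_on_twice_derivable W f c p : smooth_on W f -> dom c p -> inner X p ->
  (\forall y \near coord c p, W (param c y)) ->
  twice_derivable (f \o param c) (coord c p).
Proof.
by move=> sf dp ip Wp; apply: smooth_twice_derivable (sf c) _; exact: near_chart_image.
Qed.

Lemma near_defining_gt0 sigma c p : boundary_defining sigma -> dom c p ->
  inner X p -> \forall y \near coord c p, 0 < sigma (param c y).
Proof.
move=> [ss sb sp _] dp ip.
have Tp : nbhs (coord c p) (coord c @` (dom c `&` [set: X])).
  by apply: near_chart_image => //; exact: filterE.
have cs := smooth_continuous (ss c) Tp.
apply: (cvgr_gt _ cs); rewrite /= coordK//; exact: sp.
Qed.

(** The interior is defined through all charts at once, so that its openness is
    not visible in one of them; it follows from the fact that sigma is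
    continuous and vanishes exactly on the boundary. *)
Lemma near_inner sigma c p : boundary_defining sigma -> dom c p ->
  inner X p -> \forall y \near coord c p, inner X (param c y).
Proof.
move=> hs dp ip; have [_ sb _ _] := hs.
apply: filterS (near_defining_gt0 hs dp ip) => y sy.
by rewrite /inner -sb /= => sy0; move: sy; rewrite sy0 ltxx.
Qed.

Lemma metric_unitmx (g : riemannian_metric X) c p : dom c p -> metric g c p \in unitmx.
Proof.
move=> dp; rewrite -row_free_unit -kermx_eq0; apply/eqP/row_matrixP => i.
rewrite row0; apply/eqP; apply: contraT => r0.
have := metric_posdef g dp r0; rewrite -row_mul mulmx_ker row0 mul0mx mxE ltxx.
by [].
Qed.

Lemma metric_derivable (g : riemannian_metric X) c p i j k : dom c p -> inner X p ->
  derivable (fun y => metric g c (param c y) i j) (coord c p) (evec k).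
Proof.
move=> dp ip; apply: twice_derivable_at.
apply: smooth_twice_derivable (metric_smooth g i j) _.
have := @near_chart_image c p setT dp ip.
by rewrite setIT; apply; exact: filterE.
Qed.

Lemma ginv_derivable (g : riemannian_metric X) c p i j k : dom c p -> inner X p ->
  derivable (fun y => ginv g c (param c y) i j) (coord c p) (evec k).
Proof.
move=> dp ip; apply: derivable_invmx => [|? ?]; last exact: metric_derivable.
by apply: filterS (near_param dp ip) => y [dy _ _]; exact: metric_unitmx.
Qed.

Lemma ginv_sym (g : riemannian_metric X) c p i j : dom c p ->
  ginv g c p i j = ginv g c p j i.
Proof. by move=> dp; rewrite /ginv -{1}(metric_sym g dp) -trmx_inv mxE. Qed.

(** The Laplacian as a second order operator whose coefficients do not depend on
    w.  The Christoffel symbols occur only through their trace over i, and the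
    metric is an arbitrary tensor, so that the formula applies to g and to
    sigma^-2 g alike. *)
Lemma laplacianE (G : tensor2 X) w p (c := chart_at p) (x := coord c p) :
  inner X p -> twice_derivable (w \o param c) x ->
  (forall i j k, derivable (fun y => ginv G c (param c y) i j) x (evec k)) ->
  laplacian G w p =
  \sum_i \sum_j ('D_(evec i) ('D_(evec j) (w \o param c)) x * ginv G c p j i +
     'D_(evec j) (w \o param c) x *
       'D_(evec i) (fun y => ginv G c (param c y) j i) x) +
  \sum_j (\sum_i christoffel G c i i j p) *
     \sum_k 'D_(evec k) (w \o param c) x * ginv G c p k j.
Proof.
move=> ip dw dG; have dp := dom_chart_at p.
have gradE i : grad G w c p 0 i =
    \sum_k 'D_(evec k) (w \o param c) x * ginv G c p k i.
  by rewrite !mxE; apply: eq_bigr => k _; rewrite mxE dchartE.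
rewrite /laplacian /div -/c.
under eq_bigr do rewrite dchartE//.
rewrite big_split /=; congr (_ + _); last first.
  rewrite exchange_big /=; apply: eq_bigr => j _.
  by rewrite mulr_suml; apply: eq_bigr => i _; rewrite gradE.
apply: eq_bigr => i _.
have px : param c x = p by exact: coordK.
pose h j y := 'D_(evec j) (w \o param c) y * ginv G c (param c y) j i.
transitivity ('D_(evec i) (\sum_j h j) x).
  apply: near_eq_derive.
  have near_d : \forall y \near x, forall j,
      dchart c j w (param c y) = 'D_(evec j) (w \o param c) y.
    apply: (@filter_forall _ _ (fun j y => dchart c j w (param c y) =
      'D_(evec j) (w \o param c) y) (nbhs x)).
    by move=> j; exact: near_dchartE.
  apply: filterS near_d => y yE.
  by rewrite fct_sumE /= mxE; apply: eq_bigr => j _; rewrite mxE yE.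
have dh j : is_derive x (evec i) (h j)
    ('D_(evec i) ('D_(evec j) (w \o param c)) x * ginv G c p j i +
     'D_(evec j) (w \o param c) x *
       'D_(evec i) (fun y => ginv G c (param c y) j i) x).
  apply: is_derive_eq.
    apply: is_deriveM; apply: derivableP; [exact: dw.2|exact: dG].
  by rewrite /= px addrC; congr (_ + _); rewrite [_ *: _]mulrC.
by rewrite (@derive_val _ _ _ _ _ _ _ (is_derive_sum dh)).
Qed.

Lemma nabla_gradE (G : tensor2 X) sigma w p (c := chart_at p) (x := coord c p) :
  inner X p ->
  nabla (grad G sigma) w p =
  \sum_i \sum_j 'D_(evec j) (sigma \o param c) x * ginv G c p j i *
    'D_(evec i) (w \o param c) x.
Proof.
move=> ip; have dp := dom_chart_at p.
rewrite /nabla -/c; apply: eq_bigr => i _; rewrite mxE mulr_suml.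
by apply: eq_bigr => j _; rewrite mxE !dchartE.
Qed.

End InnerPoint.

(** * Leibniz rule for the Laplacian of a product phi(sigma) w *)

Section Leibniz.
Context {R : realType} {n : nat} (X : manifold R n) (G : tensor2 X).
Context (sigma : X -> R) (p : X) (ip : inner X p).
Implicit Types (f w : X -> R) (u : X -> R[i]) (i j k l : 'I_n.+1).

Let c := chart_at p.
Let x := coord c p.
Let dp : dom c p := dom_chart_at p.
Let S := sigma \o param c.
Let xp : param c x = p := coordK dp.

Context (dG : forall i j k,
  derivable (fun y => ginv G c (param c y) i j) x (evec k)).
Context (symG : forall i j, ginv G c p i j = ginv G c p j i).
Context (dS : twice_derivable S x).
Context (sigma_gt0 : \forall y \near x, 0 < S y).

Lemma laplacianDZ f w (a : R) :
  twice_derivable (f \o param c) x -> twice_derivable (w \o param c) x ->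
  laplacian G (fun q => f q + a * w q) p = laplacian G f p + a * laplacian G w p.
Proof.
move=> df dw; have [dfw ddfw] := twice_derivableDZ a df dw.
have D1 i := nbhs_singleton dfw i.
have D2 i j : 'D_(evec i) ('D_(evec j) ((f \o param c) + a *: (w \o param c))) x =
    'D_(evec i) ('D_(evec j) (f \o param c)) x +
    a * 'D_(evec i) ('D_(evec j) (w \o param c)) x.
  have E : {near x, 'D_(evec j) ((f \o param c) + a *: (w \o param c)) =1
      'D_(evec j) (f \o param c) + a *: 'D_(evec j) (w \o param c)}.
    by apply: filterS dfw => y ->.
  rewrite (near_eq_derive (evec i) E).
  rewrite (deriveD (df.2 i j) (derivableZ (k := a) (dw.2 i j))).
  by rewrite (deriveZ a (dw.2 i j)).
have ddfw' : twice_derivable ((fun q => f q + a * w q) \o param c) x := ddfw.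
rewrite (laplacianE ip ddfw' dG) (laplacianE ip df dG) (laplacianE ip dw dG).
rewrite -/c -/x.
have -> : (fun q => f q + a * w q) \o param c =
  (f \o param c) + a *: (w \o param c) by [].
rewrite mulrDr addrACA; congr (_ + _).
  rewrite mulr_sumr -big_split; apply: eq_bigr => i _ /=.
  rewrite mulr_sumr -big_split; apply: eq_bigr => j _ /=.
  rewrite D1 D2; move: ('D_(evec i) ('D_(evec j) _) x) ('D_(evec i) ('D_(evec j) _) x).
  move: ('D_(evec j) (f \o _) x) ('D_(evec j) (w \o _) x) ('D_(evec i) _ x).
  by move=> *; ring.
rewrite mulr_sumr -big_split; apply: eq_bigr => j _ /=.
rewrite [a * _]mulrCA -mulrDr; congr (_ * _).
rewrite mulr_sumr -big_split; apply: eq_bigr => k _ /=.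
by rewrite D1 mulrDl mulrA.
Qed.

Section RealFactor.
Context (phi dphi ddphi : R -> R).
Context (dphiP : forall t : R, 0 < t -> is_derive t 1 phi (dphi t)).
Context (ddphiP : forall t : R, 0 < t -> is_derive t 1 dphi (ddphi t)).
Context (w : X -> R) (dw : twice_derivable (w \o param c) x).

Let W := w \o param c.
Let F y := phi (S y) * W y.

Let derive1F : \forall y \near x, forall j,
  is_derive y (evec j) F
    (dphi (S y) * 'D_(evec j) S y * W y + phi (S y) * 'D_(evec j) W y).
Proof.
have [dS1 _] := dS; have [dW1 _] := dw.
apply: filterS3 dS1 dW1 sigma_gt0 => y Sy Wy S0 j.
exact: is_derive_mul (is_derive_comp1 (dphiP S0) (derivableP (Sy j)))
  (derivableP (Wy j)).
Qed.

Let derive2F i j : is_derive x (evec i) ('D_(evec j) F)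
  (ddphi (S x) * 'D_(evec i) S x * 'D_(evec j) S x * W x +
   dphi (S x) * 'D_(evec i) ('D_(evec j) S) x * W x +
   dphi (S x) * 'D_(evec j) S x * 'D_(evec i) W x +
   dphi (S x) * 'D_(evec i) S x * 'D_(evec j) W x +
   phi (S x) * 'D_(evec i) ('D_(evec j) W) x).
Proof.
have E : {near x, (fun y => dphi (S y) * 'D_(evec j) S y * W y
    + phi (S y) * 'D_(evec j) W y) =1 'D_(evec j) F}.
  apply: filterS derive1F => y /(_ j) dF.
  by rewrite (@derive_val _ _ _ _ _ _ _ dF).
apply: (near_eq_is_derive E).
have S0 := nbhs_singleton sigma_gt0.
have Sx := derivableP (twice_derivable_at (i := i) dS).
have Wx := derivableP (twice_derivable_at (i := i) dw).
have SSx := derivableP (dS.2 i j).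
have WWx := derivableP (dw.2 i j).
have dphiS : is_derive x (evec i) (fun y => dphi (S y))
    (ddphi (S x) * 'D_(evec i) S x) := is_derive_comp1 (ddphiP S0) Sx.
have phiS : is_derive x (evec i) (fun y => phi (S y))
    (dphi (S x) * 'D_(evec i) S x) := is_derive_comp1 (dphiP S0) Sx.
apply: is_derive_eq (is_deriveD (is_derive_mul (is_derive_mul dphiS SSx) Wx)
  (is_derive_mul phiS WWx)) _.
rewrite /=; have -> : w (param c x) = W x by [].
move: ('D_(evec i) ('D_(evec j) S) x) ('D_(evec i) ('D_(evec j) W) x).
move: ('D_(evec i) S x) ('D_(evec j) S x) ('D_(evec i) W x) ('D_(evec j) W x).
by move: (phi _) (dphi _) (ddphi _) (W x) => *; ring.
Qed.

Lemma twice_derivable_compM : twice_derivable F x.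
Proof.
split; first by apply: filterS derive1F => y dF i; case: (dF i).
by move=> i j; case: (derive2F i j).
Qed.

(** The cross terms d_i sigma d_j w and d_j sigma d_i w in the second derivatives
    contribute equally because the inverse metric is symmetric; together they
    give the term 2 <dsigma, dw>. *)
Lemma laplacian_compM :
  laplacian G (fun q => phi (sigma q) * w q) p =
  phi (sigma p) * laplacian G w p
  + 2 * dphi (sigma p) * nabla (grad G sigma) w p
  + (dphi (sigma p) * laplacian G sigma p
     + ddphi (sigma p) * nabla (grad G sigma) sigma p) * w p.
Proof.
have Sx : S x = sigma p by rewrite -xp.
have Wx : W x = w p by rewrite -xp.
have D1 j : 'D_(evec j) F x =
    dphi (sigma p) * 'D_(evec j) S x * w p + phi (sigma p) * 'D_(evec j) W x.
  by rewrite (@derive_val _ _ _ _ _ _ _ (nbhs_singleton derive1F j)) -Sx -Wx.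
have nsym : nabla (grad G sigma) w p = \sum_i \sum_j
    'D_(evec i) S x * ginv G c p j i * 'D_(evec j) W x.
  rewrite (nabla_gradE _ _ _ ip) exchange_big /=; apply: eq_bigr => j _.
  by apply: eq_bigr => i _; rewrite symG.
have ddF : twice_derivable ((fun q => phi (sigma q) * w q) \o param c) x.
  exact: twice_derivable_compM.
rewrite (laplacianE ip ddF dG) (laplacianE ip dS dG) (laplacianE ip dw dG).
rewrite -/c -/x -/S -/W.
have -> : (fun q => phi (sigma q) * w q) \o param c = F by [].
pose V (H : 'rV[R]_n.+1 -> R) j := \sum_k 'D_(evec k) H x * ginv G c p k j.
have VE j : V F j = dphi (sigma p) * w p * V S j + phi (sigma p) * V W j.
  rewrite /V !mulr_sumr -big_split; apply: eq_bigr => k _ /=.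
  by rewrite D1; ring.
have -> : \sum_j (\sum_i christoffel G c i i j p) * V F j =
   dphi (sigma p) * w p * (\sum_j (\sum_i christoffel G c i i j p) * V S j)
   + phi (sigma p) * (\sum_j (\sum_i christoffel G c i i j p) * V W j).
  rewrite !mulr_sumr -big_split; apply: eq_bigr => j _ /=.
  by rewrite VE; ring.
set AF := \sum_i \sum_j _.
have -> : AF =
   phi (sigma p) * (\sum_i \sum_j
      ('D_(evec i) ('D_(evec j) W) x * ginv G c p j i +
       'D_(evec j) W x * 'D_(evec i) (fun y => ginv G c (param c y) j i) x))
   + dphi (sigma p) * w p * (\sum_i \sum_j
      ('D_(evec i) ('D_(evec j) S) x * ginv G c p j i +
       'D_(evec j) S x * 'D_(evec i) (fun y => ginv G c (param c y) j i) x))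
   + dphi (sigma p) * nabla (grad G sigma) w p
   + dphi (sigma p) * (\sum_i \sum_j
       'D_(evec i) S x * ginv G c p j i * 'D_(evec j) W x)
   + ddphi (sigma p) * w p * nabla (grad G sigma) sigma p.
  rewrite !(nabla_gradE _ _ _ ip) -/c -/x -/S -/W !mulr_sumr -!big_split.
  apply: eq_bigr => i _ /=; rewrite !mulr_sumr -!big_split.
  apply: eq_bigr => j _ /=.
  rewrite D1 (@derive_val _ _ _ _ _ _ _ (derive2F i j)) Sx Wx.
  move: ('D_(evec i) ('D_(evec j) S) x) ('D_(evec i) ('D_(evec j) W) x).
  move: ('D_(evec i) S x) ('D_(evec j) S x) ('D_(evec i) W x) ('D_(evec j) W x).
  by move: ('D_(evec i) _ x) (ginv _ _ _ _ _) => *; ring.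
by rewrite -nsym; ring.
Qed.

End RealFactor.

End Leibniz.

(** * The conformal metric sigma^-2 g *)

Section ConformalChange.
Context {R : realType} {n : nat} (X : manifold R n) (g : riemannian_metric X).
Context (sigma : X -> R) (hsigma : boundary_defining sigma).
Context (p : X) (ip : inner X p).
Implicit Types (w : X -> R) (i j k l : 'I_n.+1).

Let c := chart_at p.
Let x := coord c p.
Let dp : dom c p := dom_chart_at p.
Let S := sigma \o param c.
Let xp : param c x = p := coordK dp.

Let sigma_gt0 : 0 < sigma p.
Proof. by have [_ _ + _] := hsigma; apply. Qed.

Let sigma_neq0 : sigma p != 0.
Proof. by rewrite gt_eqF. Qed.

Lemma defining_twice_derivable : twice_derivable S x.
Proof.
have [ss _ _ _] := hsigma.
by apply: smooth_on_twice_derivable ss dp ip _; exact: filterE.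
Qed.

Let dS i : is_derive x (evec i) S ('D_(evec i) S x).
Proof. exact: derivableP (twice_derivable_at defining_twice_derivable). Qed.

Lemma dnorm2E : dnorm2 g sigma p = nabla (grad g sigma) sigma p.
Proof.
rewrite (nabla_gradE _ _ _ ip) /dnorm2 -/c; apply: eq_bigr => i _; apply: eq_bigr => j _.
rewrite !(dchartE _ _ dp ip) (ginv_sym _ _ _ dp) -/x -/S.
by rewrite mulrAC [ginv _ _ _ _ _ * _]mulrC.
Qed.

Lemma ginv_conformal d q i j : dom d q -> sigma q != 0 ->
  ginv (conformal g sigma) d q i j = sigma q ^+ 2 * ginv g d q i j.
Proof.
move=> dq sq; rewrite /ginv /conformal invmxZ.
  by rewrite mxE invrK.
by rewrite unitmxZ ?metric_unitmx// unitfE invr_eq0 expf_neq0.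
Qed.

Lemma ginv_conformal_derive i j k :
  is_derive x (evec k) (fun y => ginv (conformal g sigma) c (param c y) i j)
    (2 * sigma p * 'D_(evec k) S x * ginv g c p i j +
     sigma p ^+ 2 * 'D_(evec k) (fun y => ginv g c (param c y) i j) x).
Proof.
apply: (@near_eq_is_derive _ _ _
    ((S ^+ 2) * (fun y => ginv g c (param c y) i j))).
  have sx := near_defining_gt0 hsigma dp ip.
  apply: filterS2 sx (near_param dp ip) => y sy [dy _ _].
  by rewrite ginv_conformal// gt_eqF.
have dG := derivableP (ginv_derivable (g:=g) (i:=i) (j:=j) (k:=k) dp ip).
apply: is_derive_eq (is_deriveM (is_deriveX 2 (dS k)) dG) _.
rewrite /= xp expr1.
have -> : (S ^+ 2) x = sigma p ^+ 2 by rewrite -xp.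
have -> : S x = sigma p by rewrite -xp.
rewrite /GRing.scale /=; ring.
Qed.

Lemma conformal_derive i j l :
  dchart c i (fun q => conformal g sigma c q j l) p =
  sigma p ^- 2 * dchart c i (fun q => metric g c q j l) p
  - 2 * sigma p ^- 3 * 'D_(evec i) S x * metric g c p j l.
Proof.
rewrite !dchartE// -/x.
have dV : is_derive (S x) 1 (fun t : R => t ^- 2) (- 2 * sigma p ^- 3).
  have -> : S x = sigma p by rewrite -xp.
  exact: is_derive_inv_sqr.
have dg := derivableP (metric_derivable (g := g) (i := j) (j := l) (k := i) dp ip).
have -> : (fun q => conformal g sigma c q j l) \o param c =
    ((fun t => t ^- 2) \o S) * (fun y => metric g c (param c y) j l).
  by apply/funext => y; rewrite /= /conformal mxE.
rewrite (@derive_val _ _ _ _ _ _ _ (is_deriveM (is_derive_comp1 dV (dS i)) dg)).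
have Sx : S x = sigma p by rewrite -xp.
by rewrite /= Sx xp /GRing.scale /=; ring.
Qed.

(** Before taking the trace, Gamma^k_ij changes by
    - sigma^-1 (delta^k_j d_i sigma + delta^k_i d_j sigma
                - g_ij g^kl d_l sigma).
    In the trace k = i the first and last terms cancel, and the middle one is
    multiplied by the dimension n + 1. *)
Lemma christoffel_trace_conformal j :
  \sum_i christoffel (conformal g sigma) c i i j p =
  \sum_i christoffel g c i i j p - n.+1%:R * (sigma p)^-1 * 'D_(evec j) S x.
Proof.
have gG i k : \sum_l ginv g c p i l * metric g c p k l = (i == k)%:R.
  have := @mulVmx _ _ _ (metric_unitmx g dp).
  move/matrixP/(_ i k); rewrite !mxE => <-; apply: eq_bigr => l _.
  by rewrite -{1}(metric_sym g dp) mxE.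
pose T k i l := ginv g c p k l *
  ('D_(evec i) S x * metric g c p j l + 'D_(evec j) S x * metric g c p i l
   - 'D_(evec l) S x * metric g c p i j).
have chE k i : christoffel (conformal g sigma) c k i j p =
    christoffel g c k i j p - (sigma p)^-1 * \sum_l T k i l.
  rewrite /christoffel !mulr_sumr -sumrB; apply: eq_bigr => l _.
  rewrite ginv_conformal// !conformal_derive /T.
  move: (dchart _ i _ _) (dchart _ j _ _) (dchart _ l _ _) ('D_(evec i) S x).
  by move: ('D_(evec j) S x) ('D_(evec l) S x) => *; field; rewrite sigma_neq0.
under eq_bigr do rewrite chE.
rewrite sumrB; congr (_ - _); rewrite -mulr_sumr.
suff -> : \sum_i \sum_l T i i l = n.+1%:R * 'D_(evec j) S x by ring.
under eq_bigr => i _ do under eq_bigr => l _ do rewrite /T mulrBr mulrDr.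
under eq_bigr => i _ do rewrite sumrB big_split /=.
rewrite sumrB big_split /=.
have -> : \sum_i \sum_l ginv g c p i l * ('D_(evec i) S x * metric g c p j l)
    = 'D_(evec j) S x.
  under eq_bigr => i _ do
    (under eq_bigr do rewrite mulrCA; rewrite -mulr_sumr gG).
  exact: sum_mul_delta.
have -> : \sum_i \sum_l ginv g c p i l * ('D_(evec j) S x * metric g c p i l)
    = n.+1%:R * 'D_(evec j) S x.
  under eq_bigr => i _ do (under eq_bigr do rewrite mulrCA; rewrite -mulr_sumr gG eqxx mulr1).
  by rewrite sumr_const card_ord mulr_natl.
have -> : \sum_i \sum_l ginv g c p i l * ('D_(evec l) S x * metric g c p i j)
    = 'D_(evec j) S x.
  rewrite exchange_big /=.
  have gE l : \sum_i ginv g c p i l * ('D_(evec l) S x * metric g c p i j)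
     = 'D_(evec l) S x * (l == j)%:R.
    rewrite -gG mulr_sumr; apply: eq_bigr => i _.
    by rewrite mulrCA ginv_sym// -{1}(metric_sym g dp) mxE.
  by under eq_bigr do rewrite gE; exact: sum_mul_delta.
ring.
Qed.

(** The coefficient of <dsigma, dw> is 2 - (n + 1): the derivative of the factor
    sigma^2 of the inverse metric contributes 2 sigma, the trace of the
    Christoffel symbols - (n + 1) sigma. *)
Lemma laplacian_conformal w : twice_derivable (w \o param c) x ->
  laplacian (conformal g sigma) w p =
  sigma p ^+ 2 * laplacian g w p
  - (n%:R - 1) * sigma p * nabla (grad g sigma) w p.
Proof.
move=> dw.
have dG i j k := ginv_derivable (g := g) (i := i) (j := j) (k := k) dp ip.
have dGs i j k := @ex_derive _ _ _ _ _ _ _ (ginv_conformal_derive i j k).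
rewrite (laplacianE ip dw dG) (laplacianE ip dw dGs).
rewrite -/c -/x.
set DDW := \sum_i \sum_j (_ + 'D_(evec j) (w \o param c) x * 'D_(evec i)
  (fun y => ginv g c (param c y) j i) x).
pose V j := \sum_k 'D_(evec k) (w \o param c) x * ginv g c p k j.
set DW := (X in _ * (_ + X) - _).
have nablaE : nabla (grad g sigma) w p = \sum_j 'D_(evec j) S x * V j.
  rewrite (nabla_gradE _ _ _ ip) exchange_big /=; apply: eq_bigr => j _.
  rewrite mulr_sumr; apply: eq_bigr => k _.
  by rewrite ginv_sym//; ring.
have -> : \sum_i \sum_j ('D_(evec i) ('D_(evec j) (w \o param c)) x *
      ginv (conformal g sigma) c p j i +
    'D_(evec j) (w \o param c) x *
      'D_(evec i) (fun y => ginv (conformal g sigma) c (param c y) j i) x) =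
    sigma p ^+ 2 * DDW + 2 * sigma p * nabla (grad g sigma) w p.
  rewrite nablaE !mulr_sumr -big_split; apply: eq_bigr => i _ /=.
  rewrite [in RHS]mulr_sumr mulrA mulr_sumr -big_split; apply: eq_bigr => j _ /=.
  rewrite (@derive_val _ _ _ _ _ _ _ (ginv_conformal_derive j i i)).
  by rewrite ginv_conformal//; ring.
have -> : \sum_j (\sum_i christoffel (conformal g sigma) c i i j p) *
    (\sum_k 'D_(evec k) (w \o param c) x * ginv (conformal g sigma) c p k j) =
    sigma p ^+ 2 * DW - n.+1%:R * sigma p * nabla (grad g sigma) w p.
  rewrite nablaE !mulr_sumr -sumrB; apply: eq_bigr => j _ /=.
  rewrite christoffel_trace_conformal.
  have -> : \sum_k 'D_(evec k) (w \o param c) x *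
      ginv (conformal g sigma) c p k j = sigma p ^+ 2 * V j.
    rewrite mulr_sumr; apply: eq_bigr => k _.
    by rewrite ginv_conformal// mulrCA.
  by rewrite -/(V j); field; rewrite sigma_neq0.
by rewrite -natr1; ring.
Qed.

Lemma nabla_conformal w :
  nabla (grad (conformal g sigma) sigma) w p =
  sigma p ^+ 2 * nabla (grad g sigma) w p.
Proof.
rewrite !(nabla_gradE _ _ _ ip) mulr_sumr; apply: eq_bigr => i _.
rewrite mulr_sumr; apply: eq_bigr => j _.
by rewrite ginv_conformal// [_ * (_ * ginv _ _ _ _ _)]mulrCA !mulrA.
Qed.

End ConformalChange.

(** * Complex powers and complex-valued functions *)

Section ComplexPowers.
Context {R : realType}.
Implicit Types (t : R) (z w : R[i]) (F dF : R -> R[i]).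

Lemma cpowD t z w : cpow t (z + w) = cpow t z * cpow t w.
Proof.
case: z w => [a b] [a' b']; rewrite /cpow /=; simpc.
rewrite !mulrDl expRD cosD sinD; congr (_ +i* _); ring.
Qed.

Lemma cpowN1 t : 0 < t -> cpow t (-1) = (t^-1)%:C.
Proof.
move=> t0; rewrite /cpow /= oppr0 mul0r cos0 sin0 mulr0 mulr1 mulN1r.
by rewrite expRN lnK.
Qed.

Definition is_cderive F dF t : Prop :=
  is_derive t 1 (fun s => complex.Re (F s)) (complex.Re (dF t)) /\
  is_derive t 1 (fun s => complex.Im (F s)) (complex.Im (dF t)).

Lemma is_cderiveZ z F dF t : is_cderive F dF t ->
  is_cderive (fun s => z * F s) (fun s => z * dF s) t.
Proof.
case: z => a b [FR FI].
have ReM v : complex.Re ((a +i* b) * v) = a * complex.Re v - b * complex.Im v.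
  by case: v.
have ImM v : complex.Im ((a +i* b) * v) = a * complex.Im v + b * complex.Re v.
  by case: v.
split.
  under eq_fun do rewrite ReM; rewrite ReM.
  exact: (is_deriveB (is_deriveZ a FR) (is_deriveZ b FI)).
under eq_fun do rewrite ImM; rewrite ImM.
exact: (is_deriveD (is_deriveZ a FI) (is_deriveZ b FR)).
Qed.

Lemma is_cderive_cpow z t : 0 < t ->
  is_cderive (cpow^~ z) (fun s => z * cpow s (z - 1)) t.
Proof.
move=> t0; rewrite /is_cderive cpowD cpowN1//.
case: z => a b; rewrite /cpow /=.
have dln k : is_derive t 1 (fun s => k * ln s) (k * t^-1).
  exact: is_deriveZ (is_derive1_ln t0).
have dexp := @is_derive1_comp _ _ (fun s => a * ln s) t _ _ (is_derive_expR _) (dln a).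
have dcos := @is_derive1_comp _ _ (fun s => b * ln s) t _ _ (is_derive_cos _) (dln b).
have dsin := @is_derive1_comp _ _ (fun s => b * ln s) t _ _ (is_derive_sin _) (dln b).
split.
  apply: is_derive_eq (is_deriveM dexp dcos) _.
  by rewrite /GRing.scale /=; ring.
apply: is_derive_eq (is_deriveM dexp dsin) _.
by rewrite /GRing.scale /=; ring.
Qed.

End ComplexPowers.

Section ComplexLeibniz.
Context {R : realType} {n : nat} (X : manifold R n) (G : tensor2 X).
Context (sigma : X -> R) (p : X) (ip : inner X p).

Let c := chart_at p.
Let x := coord c p.

Context (dG : forall i j k,
  derivable (fun y => ginv G c (param c y) i j) x (evec k)).
Context (symG : forall i j, ginv G c p i j = ginv G c p j i).
Context (dS : twice_derivable (sigma \o param c) x).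
Context (sigma_gt0 : \forall y \near x, 0 < (sigma \o param c) y).

(** The real and imaginary parts of Phi(sigma) u are combinations of products of
    real functions, to which the real Leibniz rule applies; the four results
    recombine because the formula is bilinear in (Phi, u). *)
Lemma complexify_laplacian_compM (Phi dPhi ddPhi : R -> R[i]) (u : X -> R[i]) :
  (forall t, 0 < t -> is_cderive Phi dPhi t) ->
  (forall t, 0 < t -> is_cderive dPhi ddPhi t) ->
  twice_derivable ((fun q => complex.Re (u q)) \o param c) x ->
  twice_derivable ((fun q => complex.Im (u q)) \o param c) x ->
  complexify (laplacian G) (fun q => Phi (sigma q) * u q) p =
  Phi (sigma p) * complexify (laplacian G) u p
  + 2 * dPhi (sigma p) * complexify (nabla (grad G sigma)) u p
  + (dPhi (sigma p) * (laplacian G sigma p)%:C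
     + ddPhi (sigma p) * (nabla (grad G sigma) sigma p)%:C) * u p.
Proof.
move=> dPhiP ddPhiP; set u1 := fun q => _; set u2 := fun q => complex.Im _.
move=> du1 du2.
have dRe t (t0 : 0 < t) := (dPhiP t t0).1.
have dIm t (t0 : 0 < t) := (dPhiP t t0).2.
have ddRe t (t0 : 0 < t) := (ddPhiP t t0).1.
have ddIm t (t0 : 0 < t) := (ddPhiP t t0).2.
have LRR := laplacian_compM ip dG symG dS sigma_gt0 dRe ddRe du1.
have LRI := laplacian_compM ip dG symG dS sigma_gt0 dRe ddRe du2.
have LIR := laplacian_compM ip dG symG dS sigma_gt0 dIm ddIm du1.
have LII := laplacian_compM ip dG symG dS sigma_gt0 dIm ddIm du2.
have TRR := twice_derivable_compM dS sigma_gt0 dRe ddRe du1.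
have TRI := twice_derivable_compM dS sigma_gt0 dRe ddRe du2.
have TIR := twice_derivable_compM dS sigma_gt0 dIm ddIm du1.
have TII := twice_derivable_compM dS sigma_gt0 dIm ddIm du2.
rewrite /complexify -/u1 -/u2.
have -> : (fun q => complex.Re (Phi (sigma q) * u q)) = (fun q =>
   complex.Re (Phi (sigma q)) * u1 q + (-1) * (complex.Im (Phi (sigma q)) * u2 q)).
  apply/funext => q; rewrite /u1 /u2; case: (Phi _) (u q) => [a b] [a' b'] /=.
  by rewrite mulN1r.
have -> : (fun q => complex.Im (Phi (sigma q) * u q)) = (fun q =>
   complex.Re (Phi (sigma q)) * u2 q + 1 * (complex.Im (Phi (sigma q)) * u1 q)).
  apply/funext => q; rewrite /u1 /u2; case: (Phi _) (u q) => [a b] [a' b'] /=.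
  by rewrite mul1r.
rewrite (laplacianDZ ip dG (-1) TRR TII) (laplacianDZ ip dG 1 TRI TIR).
rewrite LRR LRI LIR LII.
have -> : u p = u1 p +i* u2 p by rewrite /u1 /u2; case: (u p).
have -> : (2 : R[i]) = (2 : R)%:C by rewrite rmorph_nat.
move: (laplacian G u1 p) (laplacian G u2 p) (laplacian G sigma p).
move: (nabla _ u1 p) (nabla _ u2 p) (nabla _ sigma p) (u1 p) (u2 p).
case: (Phi _) (dPhi _) (ddPhi _) => [a b] [a' b'] [a'' b''] * /=.
by simpc; congr (_ +i* _); ring.
Qed.

End ComplexLeibniz.

(** * The conjugation formula *)

Theorem theorem2 (R : realType) (n : nat) (X : manifold R n)
    (g : riemannian_metric X) (sigma : X -> R)
    (hsigma : boundary_defining sigma) :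
  exists U : set X, [/\ open U, boundary X `<=` U &
    forall (lambda : R[i]) (u : X -> R[i]),
      csmooth_on (inner X) u -> inner_support u `<=` U ->
      forall p : X, inner X p ->
        laplace_robin g sigma lambda u p
        + cpow (sigma p) (lambda - 1) *
          shifted_laplacian (conformal g sigma) lambda
            (fun q => cpow (sigma q) (- lambda) * u q) p
        = lambda * (n%:R + lambda) *
          ((sigma p)^-1 * (calS g sigma p - 1))%:C * u p].
Proof.
exists setT; split; [exact: openT|by []|].
move=> lambda u [su1 su2] _ p ip.
have dp := dom_chart_at p.
have s0 : 0 < sigma p by have [_ _ + _] := hsigma; apply.
have dS := defining_twice_derivable hsigma ip.
have S0 := near_defining_gt0 hsigma dp ip.
have nI := near_inner hsigma dp ip.
have du1 := smooth_on_twice_derivable su1 dp ip nI.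
have du2 := smooth_on_twice_derivable su2 dp ip nI.
have dGs i j k := @ex_derive _ _ _ _ _ _ _ (ginv_conformal_derive g hsigma ip i j k).
have symGs i j : ginv (conformal g sigma) (chart_at p) p i j =
    ginv (conformal g sigma) (chart_at p) p j i.
  by rewrite !ginv_conformal ?gt_eqF// (ginv_sym _ _ _ dp).
have dP t (t0 : 0 < t) := is_cderive_cpow (- lambda) t0.
have ddP t (t0 : 0 < t) := is_cderiveZ (- lambda) (is_cderive_cpow (- lambda - 1) t0).
have Leib := complexify_laplacian_compM ip dGs symGs dS S0 dP ddP du1 du2.
have lapu : complexify (laplacian (conformal g sigma)) u p =
    (sigma p)%:C ^+ 2 * complexify (laplacian g) u p
    - (n%:R - 1) * (sigma p)%:C * complexify (nabla (grad g sigma)) u p.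
  rewrite /complexify !(laplacian_conformal g hsigma ip)//.
  have -> : (n%:R - 1 : R[i]) = (n%:R - 1 : R)%:C.
    by rewrite rmorphB rmorph1 rmorph_nat.
  by rewrite -rmorphXn; simpc.
have nabu : complexify (nabla (grad (conformal g sigma) sigma)) u p =
    (sigma p)%:C ^+ 2 * complexify (nabla (grad g sigma)) u p.
  by rewrite /complexify !(nabla_conformal g hsigma ip) -rmorphXn; simpc.
rewrite /shifted_laplacian Leib lapu nabu.
rewrite (laplacian_conformal g hsigma ip dS) (nabla_conformal g hsigma ip).
rewrite /laplace_robin /calS (dnorm2E g sigma ip).
(* The definition of rho, solved for the Laplacian of sigma. *)
have lapE : laplacian g sigma p =
    - (n%:R + 1) * rho g sigma p - sigma p * schoutenJ g p.
  by rewrite /rho; field; rewrite nat1r pnatr_eq0.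
rewrite lapE !cpowD (cpowN1 s0).
have PQ : cpow (sigma p) lambda * cpow (sigma p) (- lambda) = 1.
  by rewrite -cpowD subrr /cpow !mul0r expR0 cos0 sin0 mulr0 mulr1.
move: PQ s0.
move: (cpow _ lambda) (cpow _ (- lambda)) (complexify _ _ _) (complexify _ _ _).
move: (rho _ _ _) (schoutenJ _ _) (nabla _ _ _) (u p) (sigma p).
move=> r J D v s Q P Lu Nu PQ s0.
have s1 : s%:C != 0 by rewrite fmorph_eq0 gt_eqF.
rewrite !(rmorphD, rmorphB, rmorphN, rmorphM, rmorphXn, fmorphV, rmorph1, rmorph_nat) /=.
have P0 : P != 0 by apply: contra_eq_neq PQ => ->; rewrite mulr0 eq_sym oner_neq0.
have -> : Q = P^-1 by apply: (mulIf P0); rewrite PQ mulVf.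
by field; rewrite s1 P0.
Qed.
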